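(* Let $A$ be an artin algebra, let $S$ be a localizable simple $A$-module, and let $\eta_A\colon A\to L(A)$ be the left retraction associated to $S$. Identify $S^\perp$ with $L(A)\text{-mod}$, so that the functor $i_\lambda$ is regarded as a functor $A\text{-mod}\to L(A)\text{-mod}$. Then for every Gorenstein projective $A$-module $X$, the $L(A)$-module $i_\lambda(X)$ is Gorenstein projective. In particular, if $L(A)$ is CM-free, then so is $A$.
   Context: All algebras are artin algebras over a commutative artinian ring; modules are finitely generated left modules and $A\text{-mod}$ is their category. Left retractions. A simple $A$-module $S$ is localizable if $\mathrm{proj.dim}_A S\le 1$ and $\mathrm{Ext}^1_A(S,S)=0$. Put $S^\perp=\{X\in A\text{-mod}\mid \mathrm{Hom}_A(S,X)=0=\mathrm{Ext}^1_A(S,X)\}$. This is an exact abelian subcategory of $A\text{-mod}$ and the inclusion $i\colon S^\perp\to A\text{-mod}$ has an exact left adjoint $i_\lambda$. Let $L=i\,i_\lambda$ and let $\eta\colon \mathrm{Id}\to L$ be the unit of the adjunction $(i_\lambda,i)$. For $x\in L(A)$ let $r_x\colon A\to L(A)$, $r_x(a)=a.x$; the product $x\star y=L(\eta_A)^{-1}(L(r_y)(x))$ makes $L(A)$ an algebra and $\eta_A\colon A\to L(A)$ an algebra homomorphism, called the left retraction associated to $S$. There is an equivalence $S^\perp\simeq L(A)\text{-mod}$ under which $i$ becomes restriction of scalars along $\eta_A$ and $i_\lambda$ becomes $L(A)\otimes_A-$. Gorenstein projectives. A complex $P^\bullet$ (unbounded) of projective $A$-modules is totally acyclic if it is acyclic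 and $\mathrm{Hom}_A(P^\bullet,A)$ is also acyclic. An $A$-module $X$ is Gorenstein projective if $X\simeq \mathrm{Ker}(d^1\colon P^1\to P^2)$ for some totally acyclic $P^\bullet$. An artin algebra is CM-free if each Gorenstein projective module is projective. *)

(* Defs.v *)
From HB Require Import structures.
From mathcomp Require Import all_boot all_algebra.

Set Implicit Arguments.
Unset Strict Implicit.
Unset Printing Implicit Defensive.

Import GRing.Theory.
Local Open Scope ring_scope.

(* Rings are [pzRingType]s, i.e. possibly zero: L(A) may be the zero ring
   (for instance when A is a field and S = A). *)

Definition fin_gen (R : pzRingType) (M : lmodType R) : Prop :=
  exists (n : nat) (g : 'I_n -> M),
    forall x, exists c : 'I_n -> R, x = \sum_(i < n) c i *: g i.

(* Descending chain condition on ideals, i.e. on submodules of k^o. *)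
Definition artinian (k : comPzRingType) : Prop :=
  forall I : nat -> {pred k^o},
    (forall n, submod_closed (I n)) ->
    (forall n, {subset I n.+1 <= I n}) ->
  exists n, forall m, (n <= m)%N -> I m =i I n.

Definition artin_algebra (k : comPzRingType) (A : algType k) : Prop :=
  artinian k /\ fin_gen (A : lmodType k).

Record fgMod (R : pzRingType) := FgMod {
  fg_sort :> lmodType R;
  fg_axiom : fin_gen fg_sort }.

Lemma fin_gen_regular (R : pzRingType) : fin_gen (R^o : lmodType R).
Proof.
exists 1%N, (fun=> 1) => x; exists (fun=> x).
by rewrite big_ord1 /GRing.scale /= mulr1.
Qed.

Definition regular (R : pzRingType) : fgMod R := FgMod (@fin_gen_regular R).

Section Modules.
Variable R : pzRingType.
Implicit Types M N P S X : fgMod R.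

Definition surjective_map (U V : Type) (f : U -> V) : Prop :=
  forall v, exists u, f u = v.

Definition exact_at (U V W : lmodType R)
    (f : {linear U -> V}) (g : {linear V -> W}) : Prop :=
  forall v, g v = 0 <-> exists u, f u = v.

Definition short_exact (U V W : lmodType R)
    (f : {linear U -> V}) (g : {linear V -> W}) : Prop :=
  [/\ injective f, exact_at f g & surjective_map g].

Definition projective P : Prop :=
  forall M N (p : {linear M -> N}) (f : {linear P -> N}),
    surjective_map p -> exists h : {linear P -> M}, forall x, p (h x) = f x.

Definition simple_module S : Prop :=
  (exists x : S, x <> 0) /\
  forall U : {pred S}, submod_closed U ->
    (forall x, x \in U -> x = 0) \/ (forall x, x \in U).

Definition proj_dim_le1 M : Prop :=
  exists (P1 P0 : fgMod R) (d : {linear P1 -> P0}) (e : {linear P0 -> M}),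
    [/\ projective P1, projective P0 & short_exact d e].

(* Ext^1 in the sense of Yoneda: every extension 0 -> X -> E -> S -> 0 is
   equivalent to the trivial one; such an [h] is automatically bijective. *)
Definition Ext1_zero S X : Prop :=
  forall (E : fgMod R) (f : {linear X -> E}) (g : {linear E -> S}),
    short_exact f g ->
  exists h : {linear E -> (X * S)%type},
    (forall x, h (f x) = (x, 0)) /\ (forall e, (h e).2 = g e).

Definition Hom_zero S X : Prop := forall (f : {linear S -> X}) (s : S), f s = 0.

Definition localizable S : Prop := proj_dim_le1 S /\ Ext1_zero S S.

Definition perp S X : Prop := Hom_zero S X /\ Ext1_zero S X.

Record complex := Complex {
  cpx_obj :> int -> fgMod R;
  cpx_diff : forall n : int, {linear cpx_obj n -> cpx_obj (n + 1)};
  cpx_diffK : forall n x, cpx_diff (n + 1) (cpx_diff n x) = 0 }.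

Definition acyclic (P : complex) : Prop :=
  forall n : int, exact_at (cpx_diff P n) (cpx_diff P (n + 1)).

(* Exactness of Hom_R(P, N) at Hom_R(P^(n+1), N), for every n. *)
Definition Hom_acyclic (P : complex) N : Prop :=
  forall (n : int) (f : {linear P (n + 1) -> N}),
    (forall x, f (cpx_diff P n x) = 0) <->
    exists g : {linear P (n + 1 + 1) -> N},
      forall x, g (cpx_diff P (n + 1) x) = f x.

Definition totally_acyclic (P : complex) : Prop :=
  [/\ forall n, projective (P n), acyclic P & Hom_acyclic P (regular R)].

(* The isomorphism X ~ Ker d^1 is given as an injective map X -> P^1 with
   image Ker d^1. *)
Definition gorenstein_projective X : Prop :=
  exists (P : complex) (j : {linear X -> P 1}),
    [/\ totally_acyclic P, injective j & exact_at j (cpx_diff P 1)].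

Definition cm_free : Prop :=
  forall X, gorenstein_projective X -> projective X.

Record perpMod S := PerpMod {
  perp_mod :> fgMod R;
  perp_axiom : perp S perp_mod }.

(* A left adjoint of the inclusion i : S^perp -> R-mod, which is the coercion
   [perp_mod]: a functor together with a natural transformation Id -> i i_lambda
   whose components are universal arrows to i. *)
Record left_adjoint S := LeftAdjoint {
  la_obj : fgMod R -> perpMod S;
  la_mor : forall X Y : fgMod R, {linear X -> Y} -> {linear la_obj X -> la_obj Y};
  la_id : forall (X : fgMod R) (f : {linear X -> X}), f =1 id -> la_mor f =1 id;
  la_comp : forall (X Y Z : fgMod R) (f : {linear X -> Y}) (g : {linear Y -> Z})
      (h : {linear X -> Z}), h =1 g \o f -> la_mor h =1 la_mor g \o la_mor f;
  la_unit : forall X, {linear X -> la_obj X};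
  la_natural : forall (X Y : fgMod R) (f : {linear X -> Y}) x,
    la_mor f (la_unit X x) = la_unit Y (f x);
  la_universal : forall (X : fgMod R) (Y : perpMod S) (f : {linear X -> Y}),
    exists g : {linear la_obj X -> Y}, forall x, g (la_unit X x) = f x;
  la_unique : forall (X : fgMod R) (Y : perpMod S) (g h : {linear la_obj X -> Y}),
    (forall x, g (la_unit X x) = h (la_unit X x)) -> g =1 h }.

End Modules.

Section SurjInverse.
Variables (U : choiceType) (V : eqType) (f : U -> V) (f_surj : surjective_map f).

Lemma surj_inv_subproof v : exists u, f u == v.
Proof. by have [u fu] := f_surj v; exists u; apply/eqP. Qed.

Definition surj_inv (v : V) : U := xchoose (surj_inv_subproof v).

Lemma surj_invK : cancel surj_inv f.
Proof. by move=> v; apply/eqP/(xchooseP (surj_inv_subproof v)). Qed.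

Lemma surj_inv_can : injective f -> cancel f surj_inv.
Proof. by move=> f_inj u; apply: f_inj; rewrite surj_invK. Qed.

End SurjInverse.

Section LeftRetraction.
Variables (R : pzRingType) (S : fgMod R) (adj : left_adjoint S).

Local Notation L := (la_obj adj).
Local Notation Lmor := (la_mor adj).
Local Notation eta := (la_unit adj).
Local Notation LA := (L (regular R)).

Lemma unit_bij (M : perpMod S) : injective (eta M) /\ surjective_map (eta M).
Proof.
have [g gK] := la_universal adj (idfun : {linear M -> M}).
split=> [x y exy|y]; first by rewrite -[x]gK exy gK.
exists (g y).
have := @la_unique _ _ adj _ _ (eta M \o g : {linear _ -> L M}) idfun.
by apply=> x /=; rewrite gK.
Qed.

Lemma la_mor_unit : Lmor (eta (regular R)) =1 eta LA.
Proof. by apply: (@la_unique _ _ adj) => x; rewrite la_natural. Qed.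

Lemma la_mor_unit_surj : surjective_map (Lmor (eta (regular R))).
Proof.
by move=> y; have [x <-] := (unit_bij LA).2 y; exists x; rewrite la_mor_unit.
Qed.

Definition rmult (M : fgMod R) (m : M) (a : regular R) : M := (a : R) *: m.

Lemma rmult_linear (M : fgMod R) (m : M) : linear (rmult m).
Proof. by move=> a x y; rewrite /rmult scalerDl scalerA. Qed.

HB.instance Definition _ (M : fgMod R) (m : M) :=
  GRing.isLinear.Build R (regular R) M _ (rmult m) (rmult_linear m).

(* The product of L(A): L(eta_A)^-1 (L(r_y)(x)). *)
Definition star (x y : LA) : LA :=
  surj_inv la_mor_unit_surj (Lmor (rmult y) x).

(* The left action of L(A) on an object M of S^perp,
   b . m = eta_M^-1 (L(r_m)(b)): this is the inverse of the restriction
   equivalence L(A)-mod ~ S^perp. *)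
Definition perp_act (M : perpMod S) (b : LA) (m : M) : M :=
  surj_inv (unit_bij M).2 (Lmor (rmult m) b).

Lemma star_act x y : star x y = perp_act x y.
Proof.
apply: (unit_bij LA).1; rewrite /perp_act surj_invK -la_mor_unit.
exact: surj_invK.
Qed.

Section Action.
Variable M : perpMod S.
Implicit Types (m : M) (b : LA).

Lemma perp_act_eta a m : perp_act (eta (regular R) a) m = (a : R) *: m.
Proof. by rewrite /perp_act la_natural surj_inv_can //; case: (unit_bij M). Qed.

Definition perp_act_on m b : M := perp_act b m.

Lemma perp_act_linear m : linear (perp_act_on m).
Proof.
rewrite /perp_act_on; move=> a x y; apply: (unit_bij M).1.
by rewrite !linearP /perp_act !surj_invK linearP.
Qed.

HB.instance Definition _ m :=
  GRing.isLinear.Build R LA M _ (perp_act_on m) (perp_act_linear m).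

Lemma perp_act_ext m (g : {linear LA -> M}) :
  (forall a, g (eta (regular R) a) = (a : R) *: m) ->
  forall b, g b = perp_act b m.
Proof.
move=> gE; apply: (@la_unique _ _ adj _ _ g (perp_act_on m)) => a.
by rewrite gE /= /perp_act_on perp_act_eta.
Qed.

Lemma perp_act1 m : perp_act (eta (regular R) 1) m = m.
Proof. by rewrite perp_act_eta scale1r. Qed.

Lemma perp_actDl m : {morph (@perp_act M)^~ m : b c / b + c}.
Proof. by move=> b c; exact: (linearD (perp_act_on m)). Qed.

Lemma perp_actDr b : {morph @perp_act M b : m n / m + n}.
Proof.
move=> m n; symmetry.
apply: (perp_act_ext (m := m + n)
  (g := perp_act_on m \+ perp_act_on n)) => a /=.
by rewrite /perp_act_on !perp_act_eta scalerDr.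
Qed.

End Action.

Lemma perp_actA (M : perpMod S) (b c : LA) (m : M) : perp_act b (perp_act c m) = perp_act (star b c) m.
Proof.
symmetry; rewrite star_act.
apply: (perp_act_ext (m := perp_act c m)
  (g := perp_act_on m \o perp_act_on c)) => a /=.
by rewrite {2}/perp_act_on perp_act_eta linearZ.
Qed.

Definition left_retraction_ring : Type := LA.
Local Notation LAr := left_retraction_ring.

HB.instance Definition _ := GRing.Zmodule.copy LAr LA.

Lemma starA : associative star.
Proof. by move=> x y z; rewrite !star_act perp_actA star_act. Qed.

Lemma star1l : left_id (eta (regular R) 1) star.
Proof. by move=> x; rewrite star_act perp_act1. Qed.

Lemma star1r : right_id (eta (regular R) 1) star.
Proof.
move=> x; rewrite star_act; symmetry.
apply: (@perp_act_ext _ _ idfun) => a /=.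
by rewrite -linearZ /= /GRing.scale /= mulr1.
Qed.

Lemma starDl : left_distributive star +%R.
Proof. by move=> x y z; rewrite !star_act perp_actDl. Qed.

Lemma starDr : right_distributive star +%R.
Proof. by move=> x y z; rewrite !star_act perp_actDr. Qed.

HB.instance Definition _ :=
  GRing.Zmodule_isPzRing.Build LAr starA star1l star1r starDl starDr.

Definition left_retraction (a : R) : LAr := eta (regular R) a.

Lemma left_retraction_additive : {morph left_retraction : a b / a - b}.
Proof. by move=> a b; exact: (linearB (eta (regular R))). Qed.

HB.instance Definition _ :=
  GRing.isZmodMorphism.Build R LAr left_retraction left_retraction_additive.

Lemma left_retraction_multiplicative : monoid_morphism left_retraction.
Proof.
split=> // a b; rewrite /left_retraction.
transitivity (star (eta (regular R) a) (eta (regular R) b)) => //.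
by rewrite star_act perp_act_eta -linearZ.
Qed.

HB.instance Definition _ :=
  GRing.isMonoidMorphism.Build R LAr left_retraction
    left_retraction_multiplicative.

Definition perp_carrier (M : perpMod S) : Type := M.

HB.instance Definition _ (M : perpMod S) :=
  GRing.Zmodule.copy (perp_carrier M) M.

Definition perp_scale (M : perpMod S) (b : LAr) (m : perp_carrier M) :
  perp_carrier M := perp_act b m.

Section PerpModule.
Variable M : perpMod S.

Lemma perp_scaleA b c (m : perp_carrier M) :
  perp_scale b (perp_scale c m) = perp_scale (b * c) m.
Proof. exact: perp_actA. Qed.

Lemma perp_scale1 : left_id 1 (@perp_scale M).
Proof. exact: perp_act1. Qed.

Lemma perp_scaleDr : right_distributive (@perp_scale M) +%R.
Proof. by move=> b m n; exact: perp_actDr. Qed.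

Lemma perp_scaleDl (m : perp_carrier M) :
  {morph (@perp_scale M)^~ m : b c / b + c}.
Proof. exact: perp_actDl. Qed.

HB.instance Definition _ :=
  GRing.Zmodule_isLmodule.Build LAr (perp_carrier M)
    perp_scaleA perp_scale1 perp_scaleDr perp_scaleDl.

(* Restricting this structure along eta_A gives M back. *)
Lemma perp_restrict (a : R) (m : M) :
  left_retraction a *: (m : perp_carrier M) = a *: m.
Proof. exact: perp_act_eta. Qed.

Lemma perp_fin_gen : fin_gen (perp_carrier M : lmodType LAr).
Proof.
have [n [g gen]] := fg_axiom M.
exists n, g => x; have [c ->] := gen x.
exists (fun i => left_retraction (c i)).
by apply: eq_bigr => i _; rewrite perp_restrict.
Qed.

Definition perp_to_LA : fgMod LAr := FgMod perp_fin_gen.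

End PerpModule.

(* i_lambda viewed as a functor from A-mod to L(A)-mod, on objects. *)
Definition i_lambda (X : fgMod R) : fgMod LAr := perp_to_LA (L X).

End LeftRetraction.

(* Main.v *)
From HB Require Import structures.
Require Import Defs.
From mathcomp Require Import all_boot all_algebra boolp.

Set Implicit Arguments.
Unset Strict Implicit.
Unset Printing Implicit Defensive.

Import GRing.Theory.
Local Open Scope ring_scope.

(** Let I be the annihilator of the simple module S. Everything rests on three
    properties of this two-sided ideal.
    - A/I is, as a left module, a finite direct sum of copies of S, so each
      module killed by I is a sum of copies of S.
    - I is a finitely generated projective left module: the resolution of S of
      length one gives one of A/I, and Schanuel's comparison with A -> A/I
      makes I a summand of a sum of copies of P1 and A
      ([annihilator_decomposition]).
    - I is idempotent. A linear map I -> S extends to A because Ext^1(S,S) = 0,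
      hence is zero because I kills S; but I/I^2 is a sum of copies of S
      ([annihilator_idempotent]).
    The localization is then explicit: i_lambda(X) is Hom_A(I, X), with A acting
    through right multiplication on I and unit x |-> (i |-> ix). Idempotence
    puts Hom_A(I, X) in the perpendicular category, and vanishing of Hom(S, Y)
    and Ext^1(S, Y) says that Y -> Hom_A(I, Y) is bijective, which is the
    universal property ([left_adjoint_hom]). This functor is exact because I is
    projective, and the kernel and cokernel of its unit are killed by I.

    Call N good for a totally acyclic complex P if Hom_A(P, N) is exact
    ([hom_exact]). A is good by definition, so are projectives, then S by its
    projective resolution, then every module killed by I. The four-term sequence
    of the unit shows that X is good if and only if i_lambda(X) is
    ([hom_exact_unit]).

    Apply i_lambda to P. The result is acyclic by exactness and consists of
    projective L(A)-modules, since a dual basis is carried to a dual basis. Its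
    maps into L(A) are the A-linear maps P -> L(A), which form an exact complex
    because A, hence L(A), is good. This is the first assertion. For the second,
    let X be the kernel of d^1 in P with i_lambda(X) projective, that is a
    summand of L(A)^n. Then i_lambda(X), hence X, is good, so the map P^0 -> X
    that kills the image of P^(-1) extends to P^1; the extension retracts P^1
    onto X. *)

(** * Linear maps and dual bases *)

Section LinearMaps.
Variable R : pzRingType.

Section Make.
Variables (U V : lmodType R) (f : U -> V) (f_lin : linear f).

Definition linear_of_fun : U -> V := f.

HB.instance Definition _ := GRing.isLinear.Build R U V _ linear_of_fun f_lin.

Lemma linear_exists : exists g : {linear U -> V}, g =1 f.
Proof. by exists linear_of_fun. Qed.

End Make.

Lemma linear_factor_inj (U V W : lmodType R) (f : {linear U -> W})
    (m : {linear V -> W}) :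
  injective m -> (forall u, exists v, m v = f u) ->
  exists g : {linear U -> V}, forall u, m (g u) = f u.
Proof.
move=> m_inj /choice[g gE].
have g_lin : linear g.
  by move=> a x y; apply: m_inj; rewrite linearP !gE linearP.
by have [h hE] := linear_exists g_lin; exists h => u; rewrite hE.
Qed.

Lemma linear_factor_surj (U V W : lmodType R) (f : {linear U -> W})
    (p : {linear U -> V}) :
  surjective_map p -> (forall u, p u = 0 -> f u = 0) ->
  exists g : {linear V -> W}, forall u, g (p u) = f u.
Proof.
move=> /choice[s sE] pf0.
have fs u : f (s (p u)) = f u.
  by apply/eqP; rewrite -subr_eq0 -linearB pf0 // linearB sE subrr.
have g_lin : linear (f \o s).
  by move=> a x y /=; rewrite -(sE x) -(sE y) -linearP !fs linearP.
by have [h hE] := linear_exists g_lin; exists h => u; rewrite hE /= fs.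
Qed.

(** By the dual basis lemma, [dual_basis M] says that M is finitely generated
    projective. Unlike [projective], it gives liftings along maps of arbitrary
    modules, not only of finitely generated ones, and it makes sense before M
    is known to be finitely generated. *)
Definition dual_basis (M : lmodType R) : Prop :=
  exists (T : finType) (e : T -> M) (c : T -> {linear M -> R^o}),
    forall x, x = \sum_t (c t x : R) *: e t.

Lemma linear_sum_scale (M N : lmodType R) (T : finType)
    (c : T -> {linear M -> R^o}) (e : T -> N) :
  exists g : {linear M -> N}, forall x, g x = \sum_t (c t x : R) *: e t.
Proof.
apply: linear_exists => a x y /=; rewrite scaler_sumr -big_split /=.
by apply: eq_bigr => t _; rewrite linearP scalerDl scalerA.
Qed.

Lemma dual_basis_lift (P M N : lmodType R) (p : {linear M -> N})
    (f : {linear P -> N}) :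
  dual_basis P -> (forall x, exists m, p m = f x) ->
  exists h : {linear P -> M}, forall x, p (h x) = f x.
Proof.
move=> [T [e [c cE]]] lift; have [s sE] := choice (fun t => lift (e t)).
have [h hE] := linear_sum_scale c s; exists h => x.
rewrite hE {2}[x]cE !linear_sum; apply: eq_bigr => t _.
by rewrite !linearZ sE.
Qed.

Lemma dual_basis_projective (P : fgMod R) : dual_basis P -> projective P.
Proof.
by move=> dbP M N p f p_surj; apply: dual_basis_lift.
Qed.

Lemma dual_basis_retract (P Q : lmodType R) (s : {linear Q -> P})
    (r : {linear P -> Q}) :
  cancel s r -> dual_basis P -> dual_basis Q.
Proof.
move=> sK [T [e [c cE]]].
exists T, (fun t => r (e t)), (fun t => c t \o s) => x /=.
rewrite -{1}[x]sK {1}[s x]cE linear_sum.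
by apply: eq_bigr => t _; rewrite linearZ.
Qed.

Lemma fin_gen_row n : fin_gen ('rV[R]_n : lmodType R).
Proof.
exists n, (fun i => delta_mx 0 i) => x; exists (fun i => x 0 i).
exact: row_sum_delta.
Qed.

Lemma row_coordinates n : exists c : 'I_n -> {linear 'rV[R]_n -> R^o},
  forall i x, c i x = x 0 i.
Proof.
have coord i : exists f : {linear 'rV[R]_n -> R^o}, f =1 (fun x => x 0 i).
  by apply: linear_exists => a x y; rewrite !mxE.
by have [c cE] := choice coord; exists c.
Qed.

Lemma dual_basis_row n : dual_basis ('rV[R]_n : lmodType R).
Proof.
have [c cE] := row_coordinates n.
exists 'I_n, (fun i => delta_mx 0 i), c => x.
by rewrite {1}[x]row_sum_delta; apply: eq_bigr => i _; rewrite cE.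
Qed.

Lemma projective_dual_basis (P : fgMod R) : projective P -> dual_basis P.
Proof.
move=> projP; have [n [g gen]] := fg_axiom P.
have [c cE] := row_coordinates n.
have [p pE] := linear_sum_scale c g.
have p_surj : surjective_map p.
  move=> x; have [a ->] := gen x; exists (\row_i a i); rewrite pE.
  by apply: eq_bigr => i _; rewrite cE mxE.
have [s sK] := projP (FgMod (fin_gen_row n)) P p idfun p_surj.
exact: dual_basis_retract sK (dual_basis_row n).
Qed.

Lemma projective_retract (P Q : fgMod R) (s : {linear Q -> P})
    (r : {linear P -> Q}) :
  cancel s r -> projective P -> projective Q.
Proof.
move=> sK /projective_dual_basis dbP.
exact/dual_basis_projective/(dual_basis_retract sK).
Qed.

End LinearMaps.

(** * Submodules and quotients *)

Section SubQuotients.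
Variable R : pzRingType.

Section Sub.
Variables (M : lmodType R) (U : {pred M}) (U_closed : submod_closed U).

(** An alias of [U] that carries the closure proof, so that the submodule and
    quotient structures can be inferred from the predicate. *)
Definition sub_pred of submod_closed U : {pred M} := U.
Local Notation Up := (sub_pred U_closed).

HB.instance Definition _ := GRing.isSubmodClosed.Build R M Up U_closed.

Record submodule := Submodule { sub_val : M; sub_valP : sub_val \in Up }.
HB.instance Definition _ := [isSub for sub_val].
HB.instance Definition _ := [Choice of submodule by <:].
HB.instance Definition _ := [SubChoice_isSubLmodule of submodule by <:].

Lemma submodule_exists :
  exists (K : lmodType R) (k : {linear K -> M}),
    injective k /\ (forall x, x \in U <-> exists u, k u = x).
Proof.
exists submodule, val; split; first exact: val_inj.
by move=> x; split=> [Ux|[u <-]]; [exists (Submodule Ux) | exact: sub_valP].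
Qed.

Local Open Scope quotient_scope.

Definition quotient_module : Type := Quotient.quot Up.
HB.instance Definition _ := GRing.Zmodule.on quotient_module.

Definition quotient_pi (x : M) : quotient_module := \pi_(Quotient.quot Up) x.

Lemma quotient_piE x y : (quotient_pi x = quotient_pi y) <-> (x - y \in U).
Proof.
rewrite (_ : (x - y \in U) = (x - y \in Up)) // Quotient.idealrBE.
by split=> [|/eqP //]; rewrite /quotient_pi => ->.
Qed.

Lemma quotient_pi_surj : surjective_map quotient_pi.
Proof. by move=> x; exists (repr x); rewrite /quotient_pi reprK. Qed.

Lemma quotient_piD : {morph quotient_pi : x y / x + y}.
Proof. by move=> x y; rewrite /quotient_pi raddfD. Qed.

Definition quotient_scale (a : R) (x : quotient_module) : quotient_module :=
  quotient_pi (a *: surj_inv quotient_pi_surj x).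

Lemma quotient_piZ a x : quotient_scale a (quotient_pi x) = quotient_pi (a *: x).
Proof.
apply/quotient_piE; rewrite -scalerBr; have [_ Ucl] := U_closed.
suff : surj_inv quotient_pi_surj (quotient_pi x) - x \in Up by exact: rpredZ.
by apply/quotient_piE; rewrite surj_invK.
Qed.

Lemma quotient_scaleA a b x :
  quotient_scale a (quotient_scale b x) = quotient_scale (a * b) x.
Proof.
by have [u <-] := quotient_pi_surj x; rewrite !quotient_piZ scalerA.
Qed.

Lemma quotient_scale1 : left_id 1 quotient_scale.
Proof.
by move=> x; have [u <-] := quotient_pi_surj x; rewrite quotient_piZ scale1r.
Qed.

Lemma quotient_scaleDr : right_distributive quotient_scale +%R.
Proof.
move=> a x y; have [u <-] := quotient_pi_surj x.
have [v <-] := quotient_pi_surj y.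
by rewrite !(quotient_piZ, =^~ quotient_piD) scalerDr.
Qed.

Lemma quotient_scaleDl x : {morph quotient_scale^~ x : a b / a + b}.
Proof.
move=> a b; have [u <-] := quotient_pi_surj x.
by rewrite !(quotient_piZ, =^~ quotient_piD) scalerDl.
Qed.

HB.instance Definition _ := GRing.Zmodule_isLmodule.Build R quotient_module
  quotient_scaleA quotient_scale1 quotient_scaleDr quotient_scaleDl.

Lemma quotient_exists :
  exists (C : lmodType R) (q : {linear M -> C}),
    surjective_map q /\ (forall x, x \in U <-> q x = 0).
Proof.
have q_lin : linear quotient_pi.
  by move=> a x y; rewrite quotient_piD -quotient_piZ.
have [q qE] := linear_exists q_lin.
exists quotient_module, q; split=> [x|x].
  by have [u <-] := quotient_pi_surj x; exists u; rewrite qE.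
by rewrite -(linear0 q) !qE quotient_piE subr0.
Qed.

End Sub.

(** Kernels and cokernels are taken among arbitrary modules: over a general ring
    the kernel of a map of finitely generated modules need not be finitely
    generated. *)
Lemma kernel_exists (M N : lmodType R) (u : {linear M -> N}) :
  exists (K : lmodType R) (k : {linear K -> M}), injective k /\ exact_at k u.
Proof.
have Ucl : submod_closed [pred x | u x == 0].
  split=> [|a x y]; rewrite !inE ?linear0 // => /eqP ux /eqP uy.
  by rewrite linearP ux uy scaler0 addr0.
have [K [k [k_inj kE]]] := submodule_exists Ucl.
by exists K, k; split=> // x; rewrite -kE inE; split=> [->|/eqP].
Qed.

Lemma cokernel_exists (M N : lmodType R) (u : {linear M -> N}) :
  exists (C : lmodType R) (q : {linear N -> C}), exact_at u q /\ surjective_map q.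
Proof.
have Ucl : submod_closed [pred y | `[< exists x, u x = y >]].
  split=> [|a x y]; rewrite !inE; first by apply/asboolP; exists 0; rewrite linear0.
  move=> /asboolP[x' <-] /asboolP[y' <-].
  by apply/asboolP; exists (a *: x' + y'); rewrite linearP.
have [C [q [q_surj qE]]] := quotient_exists Ucl.
exists C, q; split=> // x; rewrite -qE inE; split=> [/asboolP //|?].
exact/asboolP.
Qed.

End SubQuotients.

(** * Modules over the annihilator quotient of a simple module *)

Section SimpleModules.
Variable R : pzRingType.

Definition kills (a : R) (M : lmodType R) : Prop := forall x : M, a *: x = 0.

(** This is what makes [R / ann M] embed in a finite power of [M]. *)
Definition finitely_detected (M : lmodType R) : Prop :=
  exists (n : nat) (s : 'I_n -> M),
    forall a : R, (forall i, a *: s i = 0) -> kills a M.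

Definition central (a : R) : Prop := forall b : R, a * b = b * a.

(** This replaces generation over the base ring of an artin algebra: the scalars
    are only required to be central. It passes to [Hom_R(I, M)], where central
    scalars act the same way through [I] and through [M]. *)
Definition centrally_generated (M : lmodType R) : Prop :=
  exists (J : finType) (g : J -> M), forall x,
    exists2 c : J -> R, (forall j, central (c j)) & x = \sum_j c j *: g j.

Lemma centrally_generated_fin_gen (M : lmodType R) :
  centrally_generated R^o -> fin_gen M -> centrally_generated M.
Proof.
move=> [J [g gen]] [n [h hen]].
exists (J * 'I_n)%type, (fun jl => (g jl.1 : R) *: h jl.2) => x.
have [a ->] := hen x.
have /choice[c cE] l : exists c : J -> R, (forall j, central (c j)) /\
    a l = \sum_j c j *: g j by have [c cc cE] := gen (a l); exists c.
exists (fun jl => c jl.2 jl.1) => [[j l]|]; first by have [cc _] := cE l; apply: cc.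
rewrite -(pair_bigA _ (fun j l => c l j *: ((g j : R) *: h l))) exchange_big /=.
apply: eq_bigr => l _; have [_ {1}->] := cE l; rewrite scaler_suml.
by apply: eq_bigr => j _; rewrite scalerA.
Qed.

Lemma centrally_generated_detected (M : lmodType R) :
  centrally_generated M -> finitely_detected M.
Proof.
move=> [J [g gen]]; exists #|J|, (g \o enum_val) => a a0 x.
have [c cc ->] := gen x; rewrite scaler_sumr big1 // => j _.
by rewrite scalerA -cc -scalerA -[j]enum_rankK a0 scaler0.
Qed.

Lemma simple_generated (S : fgMod R) (s x : S) :
  simple_module S -> s <> 0 -> exists a : R, x = a *: s.
Proof.
move=> [_ simpleS] s_neq0.
have Ucl : submod_closed [pred y : S | `[< exists a : R, y = a *: s >]].
  split=> [|a y z]; rewrite !inE; first by apply/asboolP; exists 0; rewrite scale0r.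
  move=> /asboolP[b ->] /asboolP[c ->].
  by apply/asboolP; exists (a * b + c); rewrite scalerDl scalerA.
have [U0|UT] := simpleS _ Ucl; last by have /asboolP := UT x.
by case: s_neq0; apply: U0; apply/asboolP; exists 1; rewrite scale1r.
Qed.

Variables (S : fgMod R) (s0 : S).
Hypotheses (S_simple : simple_module S) (s0_neq0 : s0 <> 0).

(** The elements encode two maps modulo the annihilator of [S]:
    [x |-> (x * r t *: s0)_t] from [R] to copies of [S], and back
    [a *: s0 |-> a * e t]. The two conditions say that the second is well
    defined and that the composite is the identity of [R / ann S], which is
    therefore a summand of a finite sum of copies of [S]. *)
Definition matrix_units (T : finType) (r e : T -> R) : Prop :=
  (forall a t, a *: s0 = 0 -> kills (a * e t) S) /\
  kills (1 - \sum_t r t * e t) S.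

(** Take a minimal family of elements [s i] whose common annihilator is that of
    [S]. By minimality some element of [R] kills all of them but one, and since
    [S] is simple this element can be scaled to send the remaining one to [s0];
    the [e i] so obtained separate the coordinates of the embedding of
    [R / ann S] in a power of [S]. *)
Lemma matrix_units_exist : finitely_detected S ->
  exists (T : finType) (r e : T -> R), matrix_units r e.
Proof.
move=> [n [s detects]].
pose p (B : {set 'I_n}) :=
  `[< forall a : R, (forall i, i \in B -> a *: s i = 0) -> kills a S >].
have [B minB] : {B | minset p B}.
  apply: ex_minset; exists setT; apply/asboolP => a a0; apply: detects => i.
  by apply: a0.
have /asboolP pB := minsetp minB.
have re i : exists x : R * R, if i \in B then
    [/\ s i = x.1 *: s0, x.2 *: s i = s0
      & forall j, j \in B -> j != i -> x.2 *: s j = 0] else x.2 = 0.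
  have [iB|_] := boolP (i \in B); last by exists (0, 0).
  have [a [a_kills nkills]] : exists a : R,
      (forall j, j \in B :\ i -> a *: s j = 0) /\ ~ kills a S.
    apply: contrapT => /forallNP none.
    suff pBi : p (B :\ i).
      have := minsetinf minB pBi (subsetDl _ _).
      by move/setP/(_ i); rewrite !inE eqxx iB.
    by apply/asboolP => a a0; apply: contrapT => nk; apply: (none a).
  have asi : a *: s i <> 0.
    move=> asi0; apply: nkills; apply: pB => j jB.
    by have [-> //|ji] := eqVneq j i; apply: a_kills; rewrite !inE ji.
  have si : s i <> 0 by move=> si0; apply: asi; rewrite si0 scaler0.
  have [b bE] := simple_generated s0 S_simple asi.
  have [r rE] := simple_generated (s i) S_simple s0_neq0.
  exists (r, b * a); split=> //=; first by rewrite -scalerA.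
  by move=> j jB ji; rewrite -scalerA a_kills ?scaler0 // !inE ji.
have [x xE] := choice re.
exists 'I_n, (fun i => (x i).1), (fun i => (x i).2); split=> [a i as0|].
  have := xE i; case: ifP => [iB [_ xi xj]|_ ->]; last first.
    by move=> y; rewrite mulr0 scale0r.
  apply: pB => j jB; rewrite -scalerA.
  by have [->|ji] := eqVneq j i; rewrite ?xi // xj // scaler0.
apply: pB => j jB; rewrite scalerBl scale1r scaler_suml (bigD1 j) //= big1 ?addr0.
  by have := xE j; rewrite jB => -[sj xj _]; rewrite -scalerA xj -sj subrr.
move=> i ij; have := xE i; rewrite -scalerA.
by case: ifP => [iB [_ _ ->]|_ ->]; rewrite ?scale0r ?scaler0 // eq_sym.
Qed.

Lemma simple_map (Y : lmodType R) (y : Y) :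
  (forall a : R, a *: s0 = 0 -> a *: y = 0) ->
  exists f : {linear S -> Y}, forall a : R, f (a *: s0) = a *: y.
Proof.
move=> y0.
have [c cE] := choice (fun x : S => simple_generated x S_simple s0_neq0).
have fE (a : R) x : x = a *: s0 -> c x *: y = a *: y.
  move=> xE; apply/eqP; rewrite -subr_eq0 -scalerBl y0 //.
  by rewrite scalerBl -cE xE subrr.
have [f fE'] : exists f : {linear S -> Y}, f =1 (fun x => c x *: y).
  apply: linear_exists => a u v; rewrite (fE (a * c u + c v)).
    by rewrite scalerDl scalerA.
  by rewrite scalerDl -scalerA -!cE.
by exists f => a; rewrite fE'; apply: fE.
Qed.

Section Isotypic.
Variables (T : finType) (r e : T -> R).
Hypothesis units : matrix_units r e.

(** That is, [M] is a module over [R / ann S], hence a sum of copies of [S]. *)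
Definition isotypic (M : lmodType R) : Prop :=
  forall a : R, kills a S -> kills a M.

Lemma isotypic_sum (M : lmodType R) (x : M) : isotypic M ->
  x = \sum_t r t *: (e t *: x).
Proof.
move=> isoM; have := isoM _ units.2 x; rewrite scalerBl scale1r => /eqP.
rewrite subr_eq0 scaler_suml => /eqP {1}->.
by apply: eq_bigr => t _; rewrite scalerA.
Qed.

(** The [y j] generate copies of [S] whose sum is direct: the first condition
    makes the span of [y j] a quotient of [S], the second makes it nonzero and
    the sum direct. *)
Definition independent_tops (M : lmodType R) (J : finType) (y : J -> M) : Prop :=
  (forall (a : R) j, a *: s0 = 0 -> a *: y j = 0) /\
  (forall a : J -> R, \sum_j a j *: y j = 0 -> forall j, a j *: s0 = 0).

Definition spans (M : lmodType R) (J : finType) (y : J -> M) (x : M) : Prop :=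
  exists a : J -> R, x = \sum_j a j *: y j.

Lemma spans_scale_sum (M : lmodType R) (J K : finType) (y : J -> M)
   (c : K -> R) (z : K -> M) :
  (forall k, spans y (z k)) -> spans y (\sum_k c k *: z k).
Proof.
move=> /choice[a aE]; exists (fun j => \sum_k c k * a k j).
rewrite (eq_bigr (fun k => \sum_j (c k * a k j) *: y j)).
  by rewrite exchange_big; apply: eq_bigr => j _; rewrite scaler_suml.
move=> k _; rewrite {1}aE scaler_sumr.
by apply: eq_bigr => j _; rewrite scalerA.
Qed.

(** The elements [e t *: x k] generate copies of [S] and span all [x k]. A
    spanning family of least size is independent: in a nontrivial relation some
    coefficient does not kill [s0], so a left multiple of it fixes [s0], and the
    corresponding generator is redundant. *)
Lemma isotypic_basis (M : lmodType R) (K : finType) (x : K -> M) :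
  isotypic M ->
  exists (J : finType) (y : J -> M),
    independent_tops y /\ (forall k, spans y (x k)).
Proof.
move=> isoM.
pose p n := `[< exists y : 'I_n -> M,
  (forall (a : R) j, a *: s0 = 0 -> a *: y j = 0) /\
  (forall k, spans y (x k)) >].
have [n /asboolP[y [y_top y_span]] minn] :
    exists2 n, p n & forall m, p m -> (n <= m)%N.
  suff exp : exists n, p n by case: (ex_minnP exp) => n; exists n.
  pose z (kt : K * T) := e kt.2 *: x kt.1.
  exists #|{: K * T}|; apply/asboolP; exists (fun j => z (enum_val j)); split.
    by move=> a j as0; rewrite scalerA isoM //; apply: units.1.
  move=> k; pose a kt := if kt.1 == k then r kt.2 else 0.
  exists (fun j => a (enum_val j)).
  rewrite -(big_enum_val (fun kt => a kt *: z kt)) /=.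
  rewrite -(pair_bigA _ (fun k' t => a (k', t) *: z (k', t))) /=.
  rewrite (bigD1 k) //= [X in _ + X]big1 => [|k' /negPf k'k].
    rewrite addr0 {1}[x k]isotypic_sum //; apply: eq_bigr => t _.
    by rewrite /a eqxx.
  by rewrite big1 // => t _; rewrite /a k'k scale0r.
exists 'I_n, y; split=> //; split=> // a a0 i; apply: contrapT => asi.
have [b bE] := simple_generated s0 S_simple asi.
case: n y y_top y_span minn a a0 i asi b bE
  => [|n] y y_top y_span minn a a0 i asi b bE.
  by case: i {asi bE}.
suff /minn : p n by rewrite ltnn.
apply/asboolP; exists (fun j => y (lift i j)); split=> [c j|k]; first exact: y_top.
have [c ->] := y_span k; apply: spans_scale_sum => j.
have [j' ->|->] := unliftP i j.
  exists (fun l => (l == j')%:R); rewrite (bigD1 j') //= eqxx scale1r.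
  by rewrite big1 ?addr0 // => l /negPf ->; rewrite scale0r.
exists (fun j => - (b * a (lift i j))).
have: (1 - b * a i) *: y i = 0.
  by apply: y_top; rewrite scalerBl scale1r -scalerA -bE subrr.
rewrite scalerBl scale1r => /eqP; rewrite subr_eq0 => /eqP ->.
move/eqP: a0; rewrite (bigD1_ord i) //= addr_eq0 => /eqP aE.
rewrite -scalerA aE scalerN scaler_sumr -sumrN.
by apply: eq_bigr => l _; rewrite scalerA scaleNr.
Qed.

(** The image of [f] lies in a finite direct sum of copies of [S], so [f]
    amounts to a finite family of linear maps to [S]. *)
Lemma isotypic_coordinates (P M : lmodType R) (f : {linear P -> M}) :
  fin_gen P -> isotypic M ->
  exists (J : finType) (y : J -> M) (g : J -> {linear P -> S}),
    forall x (a : J -> R),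
      f x = \sum_j a j *: y j <-> (forall j, a j *: s0 = g j x).
Proof.
move=> [n [x genx]] isoM.
have [J [y [[y_top y_ind] y_span]]] := isotypic_basis (fun k => f (x k)) isoM.
have /choice[c cE] (u : P) : spans y (f u).
  have [a ->] := genx u; rewrite linear_sum.
  rewrite (eq_bigr (fun k => a k *: f (x k))); last by move=> k _; rewrite linearZ.
  exact: spans_scale_sum.
have y_eq (a b : J -> R) : \sum_j a j *: y j = \sum_j b j *: y j ->
    forall j, a j *: s0 = b j *: s0.
  move=> /eqP; rewrite -subr_eq0 -sumrB => /eqP ab0 j.
  apply/eqP; rewrite -subr_eq0 -scalerBl; apply/eqP.
  apply: (y_ind (fun j => a j - b j)); rewrite -[RHS]ab0.
  by apply: eq_bigr => l _; rewrite scalerBl.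
have g_lin j : exists g : {linear P -> S}, g =1 (fun u => c u j *: s0).
  apply: linear_exists => a u v; rewrite scalerA -scalerDl; move: j.
  apply: (y_eq _ (fun j => a * c u j + c v j)).
  rewrite -cE linearP !cE scaler_sumr -big_split; apply: eq_bigr => l _.
  by rewrite scalerDl scalerA.
have [g gE] := choice g_lin.
exists J, y, g => u a; split=> [fu j|aE].
  by rewrite gE; apply: y_eq; rewrite -fu cE.
rewrite cE; apply: eq_bigr => j _; apply/eqP; rewrite -subr_eq0 -scalerBl.
by rewrite y_top // scalerBl aE gE subrr.
Qed.

End Isotypic.
End SimpleModules.

(** * Coefficient modules that keep a complex exact *)

Section HomExact.
Variables (R : pzRingType) (P : complex R).
Hypothesis P_dual : forall n, dual_basis (P n).
Local Notation d := (cpx_diff P).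

(** Exactness of [Hom(P, N)]; only the half that is not automatic. *)
Definition hom_exact (N : lmodType R) : Prop :=
  forall (n : int) (f : {linear P (n + 1) -> N}), (forall x, f (d n x) = 0) ->
  exists g : {linear P (n + 1 + 1) -> N}, forall x, g (d (n + 1) x) = f x.

Lemma hom_exact_summand (M N : lmodType R) (T : finType)
    (a : T -> {linear N -> M}) (b : T -> {linear M -> N}) :
  (forall y, y = \sum_t b t (a t y)) -> hom_exact M -> hom_exact N.
Proof.
move=> abE exM n f fd0.
have ext t : exists g : {linear P (n + 1 + 1) -> M},
    forall x, g (d (n + 1) x) = a t (f x).
  by apply: (exM _ (a t \o f)) => x /=; rewrite fd0 linear0.
have [g gE] := choice ext.
have [h hE] : exists h : {linear P (n + 1 + 1) -> N},
    h =1 (fun x => \sum_t b t (g t x)).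
  apply: linear_exists => c x y; rewrite scaler_sumr -big_split.
  by apply: eq_bigr => t _; rewrite !linearP.
exists h => x; rewrite hE [RHS]abE; apply: eq_bigr => t _.
by rewrite gE.
Qed.

Lemma hom_exact_dual_basis (N : lmodType R) :
  dual_basis N -> hom_exact R^o -> hom_exact N.
Proof.
move=> [T [e [c cE]]].
have mul t : exists b : {linear R^o -> N}, b =1 (fun a : R => a *: e t).
  by apply: linear_exists => a x y; rewrite scalerDl scalerA.
have [b bE] := choice mul.
apply: (hom_exact_summand (a := c) (b := b)) => y.
by rewrite {1}[y]cE; apply: eq_bigr => t _; rewrite bE.
Qed.

Lemma hom_exact_shift (N : lmodType R) :
  (forall (n : int) (f : {linear P (n + 1 + 1) -> N}),
    (forall x, f (d (n + 1) x) = 0) ->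
    exists g : {linear P (n + 1 + 1 + 1) -> N},
      forall x, g (d (n + 1 + 1) x) = f x) ->
  hom_exact N.
Proof. by move=> exN n; have := exN (n - 1); rewrite subrK. Qed.

(** A chase through the long exact sequence: lift to [N0], correct the lift by a
    map to [N1], and extend. The index shift provides the degree in which the
    correcting map has to be extended. *)
Lemma hom_exact_quotient (N1 N0 N : lmodType R) (i : {linear N1 -> N0})
    (q : {linear N0 -> N}) :
  short_exact i q -> hom_exact N1 -> hom_exact N0 -> hom_exact N.
Proof.
move=> [i_inj iq q_surj] ex1 ex0; apply: hom_exact_shift => n f fd0.
have [f' f'E] := dual_basis_lift (P_dual _) (fun x => q_surj (f x)).
have [h hE] : exists h : {linear P (n + 1) -> N1},
    forall x, i (h x) = f' (d (n + 1) x).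
  apply: (linear_factor_inj (f := f' \o d (n + 1))) => // x /=.
  by apply/iq; rewrite f'E fd0.
have [x|h' h'E] := ex1 _ h.
  by apply: i_inj; rewrite hE cpx_diffK !linear0.
have [x|g gE] := ex0 _ (f' \- (i \o h')).
  by rewrite /= h'E hE subrr.
exists (q \o g) => x /=; rewrite gE linearB f'E /=.
by rewrite (_ : q _ = 0) ?subr0 //; apply/iq; exists (h' x).
Qed.

Section FourTerms.
Variables (K N M C : lmodType R).
Variables (k : {linear K -> N}) (u : {linear N -> M}) (q : {linear M -> C}).
Hypotheses (k_inj : injective k) (ku : exact_at k u).
Hypotheses (uq : exact_at u q) (q_surj : surjective_map q).
Hypotheses (exK : hom_exact K) (exC : hom_exact C).

(** This is two-out-of-three applied to both short exact sequences through the
    image of [u], done in one chase so that the image is not needed as a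
    module. *)
Lemma hom_exact_four_terms : hom_exact N <-> hom_exact M.
Proof.
have qu x : q (u x) = 0 by apply/uq; exists x.
have uk x : u (k x) = 0 by apply/ku; exists x.
split=> [exN|exM].
  apply: hom_exact_shift => n f fd0.
  have [x|g gE] := exC (f := q \o f); first by rewrite /= fd0 linear0.
  have [g' g'E] := dual_basis_lift (P_dual _) (fun x => q_surj (g x)).
  have [f' f'E] : exists f' : {linear P (n + 1 + 1) -> N},
      forall x, u (f' x) = f x - g' (d (n + 1 + 1) x).
    apply: (dual_basis_lift (f := f \- (g' \o d (n + 1 + 1)))) => // x /=.
    by apply/uq; rewrite linearB g'E gE subrr.
  have [h hE] : exists h : {linear P (n + 1) -> K},
      forall x, k (h x) = f' (d (n + 1) x).
    apply: (linear_factor_inj (f := f' \o d (n + 1))) => // x /=.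
    by apply/ku; rewrite f'E fd0 cpx_diffK linear0 subr0.
  have [x|h' h'E] := exK (f := h).
    by apply: k_inj; rewrite hE cpx_diffK !linear0.
  have [x|g'' g''E] := exN _ (f' \- (k \o h')).
    by rewrite /= h'E hE subrr.
  exists (g' \+ (u \o g'')) => x /=.
  by rewrite g''E linearB f'E uk subr0 addrC subrK.
move=> n f fd0.
have [x|g gE] := exM _ (u \o f); first by rewrite /= fd0 linear0.
have [x|h hE] := exC (f := q \o g); first by rewrite /= gE qu.
have [h' h'E] := dual_basis_lift (P_dual _) (fun x => q_surj (h x)).
have [g' g'E] : exists g' : {linear P (n + 1 + 1) -> N},
    forall x, u (g' x) = g x - h' (d (n + 1 + 1) x).
  apply: (dual_basis_lift (f := g \- (h' \o d (n + 1 + 1)))) => // x /=.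
  by apply/uq; rewrite linearB h'E hE subrr.
have [r rE] : exists r : {linear P (n + 1) -> K},
    forall x, k (r x) = f x - g' (d (n + 1) x).
  apply: (linear_factor_inj (f := f \- (g' \o d (n + 1)))) => // x /=.
  by apply/ku; rewrite linearB g'E gE cpx_diffK linear0 ?subr0 ?subrr.
have [x|r' r'E] := exK (f := r).
  by apply: k_inj; rewrite rE fd0 cpx_diffK !linear0 addr0.
exists (g' \+ (k \o r')) => x /=.
by rewrite r'E rE addrC subrK.
Qed.

End FourTerms.

(** A map to an isotypic module has finitely many coordinates, all with values
    in [S]; extend each to a map to [S], and lift it along [R -> S] to get back
    coefficients. *)
Lemma hom_exact_isotypic (S : fgMod R) (s0 : S) (T : finType) (r e : T -> R)
    (M : lmodType R) :
  simple_module S -> s0 <> 0 -> matrix_units s0 r e -> hom_exact S ->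
  isotypic S M -> hom_exact M.
Proof.
move=> simpS s0_neq0 units exS isoM n f fd0.
have [J [y [g gP]]] := isotypic_coordinates simpS units f (fg_axiom _) isoM.
have s0_surj (s : S) : exists a : R^o, rmult s0 a = s.
  by have [a ->] := simple_generated s simpS s0_neq0; exists a.
have ext j : exists c : {linear P (n + 1 + 1) -> R^o},
    forall x, (c (d (n + 1) x) : R) *: s0 = g j x.
  have [x|h hE] := exS _ (g j).
    rewrite -(iffLR (gP (d n x) (fun=> 0))) ?scale0r // fd0.
    by rewrite big1 // => l _; rewrite scale0r.
  have [c cE] := dual_basis_lift (P_dual _) (fun x => s0_surj (h x)).
  by exists c => x; rewrite -hE -cE.
have [c cE] := choice ext.
have [h hE] := linear_sum_scale c y.
by exists h => x; rewrite hE; symmetry; apply/gP => j; apply: cE.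
Qed.

End HomExact.

(** * Extending maps along a projective resolution *)

Section Extension.
Variables (R : pzRingType) (S Y : fgMod R).

Lemma fin_gen_surj (M N : lmodType R) (f : {linear M -> N}) :
  surjective_map f -> fin_gen M -> fin_gen N.
Proof.
move=> f_surj [n [g gen]]; exists n, (f \o g) => y.
have [x <-] := f_surj y; have [c ->] := gen x; exists c.
by rewrite linear_sum; apply: eq_bigr => i _; rewrite linearZ.
Qed.

Lemma fin_gen_finType (M : lmodType R) (T : finType) (g : T -> M) :
  (forall x, exists c : T -> R, x = \sum_t c t *: g t) -> fin_gen M.
Proof.
move=> gen; exists #|T|, (g \o enum_val) => x.
have [c ->] := gen x; exists (c \o enum_val).
by rewrite (big_enum_val (fun t => c t *: g t)).
Qed.

Lemma fin_gen_prod (M N : lmodType R) :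
  fin_gen M -> fin_gen N -> fin_gen (M * N)%type.
Proof.
move=> [m [g gen]] [n [h hen]].
apply: (@fin_gen_finType _ ('I_m + 'I_n)%type
  (fun t => match t with inl i => (g i, 0) | inr j => (0, h j) end)) => -[x y].
have [a ->] := gen x; have [b ->] := hen y.
exists (fun t => match t with inl i => a i | inr j => b j end).
rewrite big_sumType /=.
apply: injective_projections; rewrite /= ?raddfD /= !raddf_sum /=.
  by rewrite [X in _ + X]big1 ?addr0 // => j _; rewrite scaler0.
by rewrite [X in X + _]big1 ?add0r // => j _; rewrite scaler0.
Qed.

(** Splitting of the pushout of the resolution along [u]. *)
Lemma Ext1_zero_extend (P1 P0 : lmodType R) (d : {linear P1 -> P0})
    (p : {linear P0 -> S}) (u : {linear P1 -> Y}) :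
  fin_gen P0 -> short_exact d p -> Ext1_zero S Y ->
  exists v : {linear P0 -> Y}, forall x, v (d x) = u x.
Proof.
move=> fgP0 [d_inj dp p_surj] ext0.
(* The pushout is the cokernel of the antidiagonal map. *)
have [m mE] : exists m : {linear P1 -> (Y * P0)%type},
    m =1 (fun x => (u x, - d x)).
  apply: linear_exists => a x y; apply: injective_projections => /=.
    by rewrite linearP.
  by rewrite linearP opprD scalerN.
have [E [q [mq q_surj]]] := cokernel_exists m.
have fgE := fin_gen_surj q_surj (fin_gen_prod (fg_axiom Y) fgP0).
have [f fE] : exists f : {linear Y -> FgMod fgE}, f =1 (fun y => q (y, 0)).
  apply: linear_exists => a x y; rewrite -linearP; congr (q _).
  by apply: injective_projections; rewrite /= ?scaler0 ?addr0.
have [g gE] : exists g : {linear FgMod fgE -> S}, forall z, g (q z) = p z.2.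
  apply: (linear_factor_surj (f := p \o snd)) => //= z /mq[x <-].
  by rewrite mE /= linearN; apply/eqP; rewrite oppr_eq0; apply/eqP/dp; exists x.
have qE y x : q (y, d x) = f (y + u x).
  rewrite fE; apply/eqP; rewrite -subr_eq0 -linearB; apply/eqP/mq.
  exists (- x); rewrite mE !linearN opprK.
  by apply: injective_projections; rewrite /= ?subr0 // opprD addNKr.
have fg_exact : short_exact f g.
  split=> [|c|s]; last by have [x <-] := p_surj s; exists (q (0, x)); rewrite gE.
    suff f0 y : f y = 0 -> y = 0 by exact: raddf_inj.
    rewrite fE => /mq[x]; rewrite mE => -[<- /eqP].
    by rewrite oppr_eq0 => /eqP; rewrite -(linear0 d) => /d_inj->; rewrite linear0.
  split=> [|[y <-]]; last by rewrite fE gE /= linear0.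
  have [[y x] <-] := q_surj c; rewrite gE /= => /dp[x' <-].
  by exists (y + u x'); rewrite qE.
have [h [hf _]] := ext0 (FgMod fgE) f g fg_exact.
have [v vE] : exists v : {linear P0 -> Y}, v =1 (fun x => (h (q (0, x))).1).
  apply: linear_exists => a x y; rewrite -[RHS]/((a *: h (q (0, x)) + h (q (0, y))).1).
  rewrite -!linearP; congr (h (q _)).1.
  by apply: injective_projections; rewrite /= ?scaler0 ?addr0.
by exists v => x; rewrite vE qE hf /= add0r.
Qed.

End Extension.

(** * The localization as maps out of the annihilator *)

Section Annihilator.
Variables (R : pzRingType) (S : fgMod R) (s0 : S).
Hypotheses (S_simple : simple_module S) (s0_neq0 : s0 <> 0).
Variables (T : finType) (r e : T -> R).
Hypothesis units : matrix_units s0 r e.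
Variables (P1 P0 : fgMod R) (d : {linear P1 -> P0}) (p : {linear P0 -> S}).
Hypotheses (P1_dual : dual_basis P1) (P0_dual : dual_basis P0).
Hypothesis resolution : short_exact d p.
Hypothesis S_rigid : Ext1_zero S S.
Variables (I : lmodType R) (k : {linear I -> R^o}).
Hypotheses (k_inj : injective k)
  (k_kills : forall a : R, kills a S <-> exists i, k i = a).

Hypothesis R_central : centrally_generated R^o.

Local Notation kR i := (k i : R).

Lemma ideal_kills i : kills (kR i) S.
Proof. by apply/k_kills; exists i. Qed.

(** Comparison of [I -> R -> R / I] with the sum over [T] of the resolution of
    [S]. With [b t] over [r t *: s0] and [l] lifting [p] along [R -> S], the map
    [x |-> \sum_t l (x *: b t) * e t] agrees with the identity of [R] modulo
    [I]; it factors through copies of [P0] and, on [I], through copies of [P1].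
    The error on [i] is [i] times the element [w] of [I]. *)
Lemma annihilator_decomposition :
  exists (b : T -> P0) (a : T -> {linear I -> P1}) (c : T -> {linear P1 -> I})
      (w : I),
    (forall t i, d (a t i) = kR i *: b t) /\
    (forall i, i = \sum_t c t (a t i) + kR i *: w).
Proof.
have [d_inj dp p_surj] := resolution.
have [b bE] := choice (fun t => p_surj (r t *: s0)).
have s0_surj (s : S) : exists x : R^o, rmult s0 x = s.
  by have [x ->] := simple_generated s S_simple s0_neq0; exists x.
have [l lE] := dual_basis_lift P0_dual (fun x => s0_surj (p x)).
have aP t : exists a : {linear I -> P1}, forall i, d (a i) = kR i *: b t.
  have [f fE] : exists f : {linear I -> P0}, f =1 (fun i => kR i *: b t).
    by apply: linear_exists => x i j; rewrite linearP scalerDl scalerA.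
  have [i|a aE] := linear_factor_inj (f := f) d_inj.
    by apply/dp; rewrite fE linearZ /= bE; apply: ideal_kills.
  by exists a => i; rewrite aE fE.
have [a aE] := choice aP.
have cP t : exists c : {linear P1 -> I}, forall x, k (c x) = (l (d x) : R) * e t.
  have [f fE] : exists f : {linear P1 -> R^o}, f =1 (fun x => (l (d x) : R) * e t).
    by apply: linear_exists => x y z; rewrite !linearP mulrDl -mulrA.
  have [x|c cE] := linear_factor_inj (f := f) k_inj.
    rewrite fE; apply/k_kills/units.1.
    by rewrite [LHS](lE (d x)); apply/dp; exists x.
  by exists c => x; rewrite cE fE.
have [c cE] := choice cP.
have [w wE] : exists w, k w = 1 - \sum_t (l (b t) : R) * e t.
  apply/k_kills => s.
  rewrite scalerBl scale1r -[X in X - _](subrK (\sum_t r t * e t *: s)).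
  rewrite -{1}[s]scale1r -scaler_suml -scalerBl units.2 add0r -scalerBl -sumrB.
  rewrite scaler_suml big1 // => t _; rewrite -mulrBl; apply: units.1.
  by rewrite scalerBl -(bE t) -(lE (b t)) subrr.
exists b, a, c, w; split=> // i; apply: k_inj.
rewrite linearD linearZ wE linear_sum /= -[_ *: _]/(kR i * _) mulrBr mulr1.
rewrite [X in X + _](_ : _ = kR i * \sum_t (l (b t) : R) * e t).
  by rewrite addrC subrK.
rewrite mulr_sumr; apply: eq_bigr => t _.
by rewrite cE aE linearZ mulrA.
Qed.

Lemma annihilator_dual_basis : dual_basis I.
Proof.
have [b [a [c [w [_ decomp]]]]] := annihilator_decomposition.
have [J [y [f fE]]] := P1_dual.
exists (T * J + unit)%type,
  (fun t => match t with inl tj => c tj.1 (y tj.2) | inr _ => w end),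
  (fun t => match t return {linear I -> R^o} with
            | inl tj => f tj.2 \o a tj.1 | inr _ => k end) => i.
rewrite big_sumType /= (big_pred1 tt) => [|[]//]; rewrite {1}[i]decomp; congr (_ + _).
rewrite -(pair_bigA _ (fun t j => (f j (a t i) : R) *: c t (y j))) /=.
apply: eq_bigr => t _; rewrite {1}[a t i]fE linear_sum.
by apply: eq_bigr => j _; rewrite linearZ.
Qed.

(** This is [Ext^1(R / I, Y) = 0]: each [f \o c t] extends from [P1] to [P0],
    and the decomposition of [i] turns these extensions into one of [f]. *)
Lemma annihilator_extend (Y : fgMod R) (f : {linear I -> Y}) :
  Ext1_zero S Y -> exists y, forall i, f i = kR i *: y.
Proof.
move=> extY; have [b [a [c [w [aE decomp]]]]] := annihilator_decomposition.
have ext t := Ext1_zero_extend (f \o c t) (fg_axiom P0) resolution extY.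
have [v vE] := choice ext.
exists (\sum_t v t (b t) + f w) => i.
rewrite {1}[i]decomp linearD linearZ scalerDr scaler_sumr linear_sum.
congr (_ + _); apply: eq_bigr => t _.
by rewrite -linearZ -aE vE.
Qed.

(** This is [Hom(R / I, Y) = 0]. *)
Lemma torsionfree (Y : fgMod R) (y : Y) :
  Hom_zero S Y -> (forall i, kR i *: y = 0) -> y = 0.
Proof.
move=> hom0 ky.
have ty t : e t *: y = 0.
  have [|f fE] := simple_map S_simple s0_neq0 (y := e t *: y).
    move=> a as0; rewrite scalerA; have /k_kills[i <-] := units.1 _ t as0.
    exact: ky.
  by have := fE 1; rewrite !scale1r hom0.
have /k_kills[i iE] := units.2.
have := ky i; rewrite iE scalerBl scale1r => /eqP; rewrite subr_eq0 => /eqP->.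
by rewrite scaler_suml big1 // => t _; rewrite -scalerA ty scaler0.
Qed.

(** The quotient of [I] by its square is isotypic, so the projection onto it is
    given by maps [I -> S]. Such a map extends to [R], that is, it sends [i] to
    [i *: z] for some [z] in [S], which is zero. *)
Lemma annihilator_idempotent (x : I) :
  exists s : seq (I * I), x = \sum_(ij <- s) kR ij.1 *: ij.2.
Proof.
pose U := [pred x : I |
  `[< exists s : seq (I * I), x = \sum_(ij <- s) kR ij.1 *: ij.2 >]].
have Ucl : submod_closed U.
  split=> [|a y z]; first by apply/asboolP; exists [::]; rewrite big_nil.
  move=> /asboolP[s ->] /asboolP[s' ->]; apply/asboolP.
  exists ([seq (a *: ij.1, ij.2) | ij <- s] ++ s').
  rewrite big_cat big_map scaler_sumr; congr (_ + _).
  by apply: eq_bigr => ij _; rewrite linearZ scalerA.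
have [C [q [q_surj qU]]] := quotient_exists Ucl.
suff /qU/asboolP : q x = 0 by [].
have isoC : isotypic S C.
  move=> a /k_kills[i <-] z; have [y <-] := q_surj z.
  rewrite -linearZ; apply/qU/asboolP; exists [:: (i, y)].
  by rewrite big_seq1.
have fgI : fin_gen I.
  have [J [y [f fE]]] := annihilator_dual_basis.
  by apply: (fin_gen_finType (g := y)) => z; exists (fun j => f j z).
have [J [y [g gP]]] := isotypic_coordinates S_simple units q fgI isoC.
rewrite (iffRL (gP x (fun=> 0))).
  by rewrite big1 // => j _; rewrite scale0r.
move=> j; have [z gz] := annihilator_extend (g j) S_rigid.
by rewrite gz scale0r ideal_kills.
Qed.

Section Dual.
Variable rI : I -> R -> I.
Hypothesis rIE : forall i a, k (rI i a) = kR i * a.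

Lemma rI_linear a : linear (rI^~ a).
Proof.
move=> b i j; apply: k_inj.
by rewrite linearP !rIE linearP mulrDl -mulrA.
Qed.

Lemma rID i a b : rI i (a + b) = rI i a + rI i b.
Proof. by apply: k_inj; rewrite linearD !rIE mulrDr. Qed.

Lemma rI_mul i a b : rI i (a * b) = rI (rI i a) b.
Proof. by apply: k_inj; rewrite !rIE mulrA. Qed.

Lemma rI1 i : rI i 1 = i.
Proof. by apply: k_inj; rewrite rIE mulr1. Qed.

Lemma rI_k i j : rI j (k i) = kR j *: i.
Proof. by apply: k_inj; rewrite rIE linearZ. Qed.

Section Hom.
Variable X : fgMod R.

(** The bare linear maps [I -> X]. A type of its own is needed because the
    scalars act through right multiplication on [I], not through [X]. *)
Record ideal_hom := IdealHom { hom_fun : I -> X; hom_linear : linear hom_fun }.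
HB.instance Definition _ := gen_eqMixin ideal_hom.
HB.instance Definition _ := gen_choiceMixin ideal_hom.
HB.instance Definition _ (h : ideal_hom) :=
  GRing.isLinear.Build R I X _ (hom_fun h) (hom_linear h).

Lemma ideal_hom_ext (g h : ideal_hom) : hom_fun g =1 hom_fun h -> g = h.
Proof.
case: g h => [g gP] [h hP] /= /funext gh; move: gP; rewrite gh => gP.
by congr IdealHom; apply: Prop_irrelevance.
Qed.

Lemma hom_zero_linear : linear (fun _ : I => 0 : X).
Proof. by move=> a i j; rewrite scaler0 addr0. Qed.

Lemma hom_opp_linear (h : ideal_hom) : linear (fun i => - hom_fun h i).
Proof. by move=> a i j; rewrite linearP opprD scalerN. Qed.

Lemma hom_add_linear (g h : ideal_hom) : linear (fun i => hom_fun g i + hom_fun h i).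
Proof. by move=> a i j; rewrite !linearP scalerDr addrACA. Qed.

Lemma hom_scale_linear (a : R) (h : ideal_hom) : linear (fun i => hom_fun h (rI i a)).
Proof. by move=> b i j; rewrite rI_linear linearP. Qed.

Definition hom_add g h := IdealHom (hom_add_linear g h).
Definition hom_opp h := IdealHom (hom_opp_linear h).
Definition hom_scale a h := IdealHom (hom_scale_linear a h).

Lemma hom_addA : associative hom_add.
Proof. by move=> f g h; apply: ideal_hom_ext => i /=; rewrite addrA. Qed.

Lemma hom_addC : commutative hom_add.
Proof. by move=> f g; apply: ideal_hom_ext => i /=; rewrite addrC. Qed.

Lemma hom_add0 : left_id (IdealHom hom_zero_linear) hom_add.
Proof. by move=> f; apply: ideal_hom_ext => i /=; rewrite add0r. Qed.

Lemma hom_addN : left_inverse (IdealHom hom_zero_linear) hom_opp hom_add.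
Proof. by move=> f; apply: ideal_hom_ext => i /=; rewrite addNr. Qed.

HB.instance Definition _ :=
  GRing.isZmodule.Build ideal_hom hom_addA hom_addC hom_add0 hom_addN.

Lemma hom_scaleA a b h : hom_scale a (hom_scale b h) = hom_scale (a * b) h.
Proof. by apply: ideal_hom_ext => i /=; rewrite rI_mul. Qed.

Lemma hom_scale1 : left_id 1 hom_scale.
Proof. by move=> h; apply: ideal_hom_ext => i /=; rewrite rI1. Qed.

Lemma hom_scaleDr : right_distributive hom_scale +%R.
Proof. by move=> a g h; apply: ideal_hom_ext. Qed.

Lemma hom_scaleDl h : {morph hom_scale^~ h : a b / a + b}.
Proof. by move=> a b; apply: ideal_hom_ext => i /=; rewrite rID linearD. Qed.

HB.instance Definition _ := GRing.Zmodule_isLmodule.Build R ideal_hom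
  hom_scaleA hom_scale1 hom_scaleDr hom_scaleDl.

Lemma hom_addE (g h : ideal_hom) i : hom_fun (g + h) i = hom_fun g i + hom_fun h i.
Proof. by []. Qed.

Lemma hom_zeroE i : hom_fun 0 i = 0.
Proof. by []. Qed.

Lemma hom_scaleE (a : R) (h : ideal_hom) i : hom_fun (a *: h) i = hom_fun h (rI i a).
Proof. by []. Qed.

Lemma hom_sumE (J : Type) (s : seq J) (h : J -> ideal_hom) i :
  hom_fun (\sum_(j <- s) h j) i = \sum_(j <- s) hom_fun (h j) i.
Proof.
elim: s => [|j s IHs]; first by rewrite !big_nil hom_zeroE.
by rewrite !big_cons hom_addE IHs.
Qed.

Lemma hom_exists (f : {linear I -> X}) : exists h, hom_fun h =1 f.
Proof. by exists (IdealHom (linearP f)). Qed.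

Lemma iota_linear x : linear (fun i => kR i *: x : X).
Proof. by move=> a i j; rewrite linearP scalerDl scalerA. Qed.

(** The unit of the localization. *)
Definition iota x : ideal_hom := IdealHom (iota_linear x).

Lemma iota_is_linear : linear iota.
Proof.
move=> a x y; apply: ideal_hom_ext => i.
by rewrite hom_addE hom_scaleE /= rIE scalerDr scalerA.
Qed.
HB.instance Definition _ :=
  GRing.isLinear.Build R X ideal_hom _ iota iota_is_linear.

(** The cokernel of the unit is killed by [I]. *)
Lemma hom_scale_iota i h : kR i *: h = iota (hom_fun h i).
Proof.
by apply: ideal_hom_ext => j; rewrite hom_scaleE rI_k linearZ.
Qed.

(** Generated by the maps [i |-> f j i *: x l] for a dual basis [f] of [I] and
    central generators [x] of [X]. *)
Lemma hom_fin_gen : fin_gen ideal_hom.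
Proof.
have [K [x genx]] := centrally_generated_fin_gen R_central (fg_axiom X).
have [J [y [f fE]]] := annihilator_dual_basis.
have basis jl : exists h : ideal_hom, hom_fun h =1 (fun i => (f jl.1 i : R) *: x jl.2).
  have [h hE] : exists h : {linear I -> X}, h =1 (fun i => (f jl.1 i : R) *: x jl.2).
    by apply: linear_exists => a i j; rewrite linearP scalerDl scalerA.
  by have [h' h'E] := hom_exists h; exists h' => i; rewrite h'E hE.
have [g gE] := choice basis.
apply: (fin_gen_finType (g := g)) => h.
have /choice[c cE] j : exists c : K -> R, (forall l, central (c l)) /\
    hom_fun h (y j) = \sum_l c l *: x l.
  by have [c cc cE] := genx (hom_fun h (y j)); exists c.
exists (fun jl => c jl.1 jl.2); apply: ideal_hom_ext => i.
rewrite hom_sumE {1}[i]fE linear_sum.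
rewrite (eq_bigr (fun jl => (f jl.1 (rI i (c jl.1 jl.2)) : R) *: x jl.2)).
  2: by move=> jl _; rewrite hom_scaleE gE.
rewrite -(pair_bigA _ (fun j l => (f j (rI i (c j l)) : R) *: x l)) /=.
apply: eq_bigr => j _; have [cc hj] := cE j.
rewrite linearZ /= hj scaler_sumr; apply: eq_bigr => l _.
rewrite scalerA -cc.
have -> : rI i (c j l) = c j l *: i by apply: k_inj; rewrite rIE linearZ /= -cc.
by rewrite linearZ.
Qed.

Definition hom_mod : fgMod R := FgMod hom_fin_gen.

Lemma hom_Hom_zero : Hom_zero S hom_mod.
Proof.
move=> f s; apply: ideal_hom_ext => i.
have [ij ->] := annihilator_idempotent i; rewrite linear_sum big1 // => -[j j'] _.
by rewrite /= -rI_k -hom_scaleE -linearZ /= ideal_kills linear0.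
Qed.

Lemma hom_torsionfree (h : hom_mod) : (forall i, kR i *: h = 0) -> h = 0.
Proof. exact: torsionfree hom_Hom_zero. Qed.

(** [Hom(I, Hom(I, X)) = Hom(I (x) I, X)], and the multiplication
    [I (x) I -> I] is bijective: onto because [I] is idempotent, one-to-one
    because [I] is projective. Explicitly, a dual basis and factorizations of
    its members as sums of products give [u]. *)
Lemma hom_reflexive (w : {linear I -> hom_mod}) :
  exists u : hom_mod, forall i, w i = kR i *: u.
Proof.
have [J [y [f fE]]] := annihilator_dual_basis.
have [s sE] := choice (fun j => annihilator_idempotent (y j)).
pose v j := \sum_(ab <- s j) hom_fun (w ab.2) ab.1.
have [h hE] := linear_sum_scale f v.
have [u uE] := hom_exists h.
exists u => i; apply: ideal_hom_ext => j.
rewrite hom_scaleE rI_k linearZ /= uE hE.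
rewrite {1}[i]fE linear_sum hom_sumE scaler_sumr; apply: eq_bigr => t _.
rewrite linearZ hom_scaleE {1}[y t]sE linear_sum hom_sumE scalerA scaler_sumr.
apply: eq_bigr => -[a b] _ /=.
by rewrite linearZ hom_scaleE rI_k linearZ rIE.
Qed.

(** In an extension [E] the ideal maps [E] into the submodule [Hom(I, X)]. So
    each [x] in [E] gives a map [I -> Hom(I, X)], which by reflexivity is an
    element [rho x] of [Hom(I, X)], and [rho] splits the extension. *)
Lemma hom_Ext1_zero : Ext1_zero S hom_mod.
Proof.
move=> E f g [f_inj fg _].
have /choice[rho rhoE] (x : E) : exists u : hom_mod, forall i, f (kR i *: u) = kR i *: x.
  have [m mE] : exists m : {linear I -> E}, m =1 (fun i => kR i *: x).
    by apply: linear_exists => a i j; rewrite linearP scalerDl scalerA.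
  have [i|w wE] := linear_factor_inj (f := m) f_inj.
    by apply/fg; rewrite mE linearZ /= ideal_kills.
  by have [u uE] := hom_reflexive w; exists u => i; rewrite -uE wE mE.
have rho_uniq x u : (forall i, f (kR i *: u) = kR i *: x) -> rho x = u.
  move=> uE; apply/eqP; rewrite -subr_eq0; apply/eqP/hom_torsionfree => i.
  by apply: f_inj; rewrite scalerBr linearB rhoE uE subrr linear0.
have [h hE] : exists h : {linear E -> (hom_mod * S)%type}, h =1 (fun x => (rho x, g x)).
  apply: linear_exists => a x y; apply: injective_projections; last by rewrite /= linearP.
  apply: rho_uniq => i; rewrite /= !scalerDr linearD rhoE !scalerA; congr (_ + _).
  by rewrite -rIE rhoE.
exists h; split=> [u|x]; rewrite hE //; congr (_, _); last by apply/fg; exists u.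
by apply: rho_uniq => i; rewrite linearZ.
Qed.

Definition hom_perp : perpMod S := PerpMod (conj hom_Hom_zero hom_Ext1_zero).

(** For [Y] in the perpendicular category every linear map [I -> Y] is
    [i |-> i *: y] for a unique [y]; apply this to [f] composed with the given
    element of [Hom(I, X)]. *)
Lemma iota_universal (Y : perpMod S) (f : {linear X -> Y}) :
  exists g : {linear hom_perp -> Y}, forall x, g (iota x) = f x.
Proof.
have [homY extY] := perp_axiom Y.
have /choice[g gE] (h : hom_perp) : exists y : Y, forall i, f (hom_fun h i) = kR i *: y.
  by have [y yE] := annihilator_extend (f \o hom_fun h) extY; exists y => i; rewrite -yE.
have g_uniq h y : (forall i, f (hom_fun h i) = kR i *: y) -> g h = y.
  move=> yE; apply/eqP; rewrite -subr_eq0; apply/eqP/(torsionfree homY) => i.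
  by rewrite scalerBr -gE -yE subrr.
have [g' g'E] : exists g' : {linear hom_perp -> Y}, g' =1 g.
  apply: linear_exists => a x y; apply: g_uniq => i.
  by rewrite hom_addE linearD hom_scaleE !gE scalerDr scalerA -rIE.
by exists g' => x; rewrite g'E; apply: g_uniq => i; rewrite linearZ.
Qed.

Lemma iota_unique (Y : perpMod S) (f g : {linear hom_perp -> Y}) :
  (forall x, f (iota x) = g (iota x)) -> f =1 g.
Proof.
move=> fg h; have [homY _] := perp_axiom Y.
apply/eqP; rewrite -subr_eq0; apply/eqP/(torsionfree homY) => i.
by rewrite scalerBr -!linearZ /= hom_scale_iota fg subrr.
Qed.

End Hom.

(** Two reflections of [X] are isomorphic, so any left adjoint is [Hom(I, X)].
    The conclusion lists all that is used about it later. *)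
Lemma left_adjoint_hom (adj : left_adjoint S) :
  exists theta : forall X, la_obj adj X -> {linear I -> X},
    [/\ forall (X : fgMod R) x y, theta X x =1 theta X y -> x = y,
      forall (X : fgMod R) (h : {linear I -> X}), exists y, theta X y =1 h,
      forall (X : fgMod R) x i, theta X (la_unit adj X x) i = kR i *: x,
      forall (X : fgMod R) y i, kR i *: y = la_unit adj X (theta X y i)
    & forall (X Y : fgMod R) (f : {linear X -> Y}) y i,
        theta Y (la_mor adj f y) i = f (theta X y i)].
Proof.
have fwd (X : fgMod R) : exists g : {linear la_obj adj X -> hom_perp X},
    forall x, g (la_unit adj X x) = iota x.
  exact: (@la_universal _ _ adj X (hom_perp X) (iota (X := X))).
have bwd (X : fgMod R) := iota_universal (la_unit adj X).
pose F X := sval (cid (fwd X)); pose G X := sval (cid (bwd X)).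
have FE X : forall x, F X (la_unit adj X x) = iota x := svalP (cid (fwd X)).
have GE X : forall x, G X (iota x) = la_unit adj X x := svalP (cid (bwd X)).
have GF X : cancel (F X) (G X).
  apply: (la_unique (g := G X \o F X) (h := idfun)) => x.
  by rewrite /= FE GE.
have FG X : cancel (G X) (F X).
  apply: (@iota_unique X _ (F X \o G X) idfun) => x.
  by rewrite /= GE FE.
exists (fun (X : fgMod R) y => hom_fun (F X y) : {linear I -> X}); split.
- move=> X x y Fxy; rewrite -[x]GF -[y]GF; congr (G X _).
  exact: ideal_hom_ext.
- move=> X h; have [h' h'E] := hom_exists h.
  by exists (G X h') => i; rewrite /= FG h'E.
- by move=> X x i; rewrite /= FE.
- by move=> X y i; rewrite -[LHS]GF linearZ /= hom_scale_iota GE.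
move=> X Y f y i /=.
have hom_map_linear (h : hom_mod X) : linear (f \o hom_fun h) by exact: linearP.
have [m mE] : exists m : {linear hom_mod X -> hom_mod Y},
    m =1 (fun h => IdealHom (hom_map_linear h)).
  apply: linear_exists => a g h; apply: ideal_hom_ext => j /=.
  by rewrite linearD.
have -> : F Y (la_mor adj f y) = m (F X y).
  apply: (la_unique (Y := hom_perp Y) (g := F Y \o la_mor adj f)
    (h := m \o F X)) => x /=.
  rewrite la_natural !FE mE; apply: ideal_hom_ext => j /=.
  by rewrite linearZ.
by rewrite mE.
Qed.

End Dual.

End Annihilator.

(** * Change of scalars along the left retraction *)

Section Scalars.
Variables (R : pzRingType) (S : fgMod R) (adj : left_adjoint S).
Local Notation LA := (la_obj adj (regular R)).
Local Notation LAr := (left_retraction_ring adj).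

(** A linear map out of [LA] is determined by its composite with the unit, where
    the action is that of [R]; so every linear map preserves the action. *)
Lemma perp_act_equivariant (M N : perpMod S) (f : {linear M -> N}) (b : LA) (m : M) :
  f (perp_act b m) = perp_act b (f m).
Proof.
apply: (perp_act_ext (g := f \o @perp_act_on _ _ adj M m)) => a /=.
by rewrite /perp_act_on perp_act_eta linearZ.
Qed.

Section Extend.
Variables (M N : perpMod S) (f : {linear M -> N}).

Definition extend_scalars (m : perp_to_LA adj M) : perp_to_LA adj N := f m.

Lemma extend_scalars_linear : linear extend_scalars.
Proof.
move=> b x y; have := linearD f (perp_act b x) y.
by rewrite perp_act_equivariant.
Qed.

HB.instance Definition _ := GRing.isLinear.Build LAr (perp_to_LA adj M)
  (perp_to_LA adj N) _ extend_scalars extend_scalars_linear.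

End Extend.

Lemma restrict_scalars (M N : perpMod S)
    (f : {linear perp_to_LA adj M -> perp_to_LA adj N}) :
  exists g : {linear M -> N}, forall m, g m = f m.
Proof.
apply: linear_exists => a x y; rewrite -!(perp_restrict adj).
exact: (linearP f (left_retraction adj a) x y).
Qed.

(** The carrier of [LA], as an object of the perpendicular category and as the
    regular module of the localized ring, has two definitions of the action,
    which [star_act] identifies. *)
Lemma restrict_scalars_regular (M : perpMod S)
    (f : {linear perp_to_LA adj M -> LAr^o}) :
  exists g : {linear M -> LA}, forall m, g m = f m.
Proof.
have [|f' f'E] := @linear_exists _ (perp_to_LA adj M) (perp_to_LA adj LA) f.
  move=> b x y; rewrite linearP; congr (_ + _); exact: (star_act b (f x)).
by have [g gE] := restrict_scalars f'; exists g => m; rewrite gE f'E.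
Qed.

Lemma extend_scalars_regular (M : perpMod S) (f : {linear M -> LA}) :
  exists g : {linear perp_to_LA adj M -> LAr^o}, forall m, g m = f m.
Proof.
apply: linear_exists => b x y; rewrite [LHS](linearP (extend_scalars f)).
by congr (_ + _); exact: (esym (star_act b (f x))).
Qed.
End Scalars.

(** * Gorenstein projective modules under localization *)

Section Localization.
Variables (R : pzRingType) (S : fgMod R) (adj : left_adjoint S).
Local Notation LA := (la_obj adj (regular R)).
Local Notation LAr := (left_retraction_ring adj).
Local Notation L := (la_obj adj).
Local Notation Lmor := (la_mor adj).
Local Notation eta := (la_unit adj).

(** A dual basis is a factorization of the identity of [P] through a finite sum
    of copies of [R]; the functor carries it to one through copies of [LA]. *)
Lemma la_dual_basis (P : fgMod R) : dual_basis P -> dual_basis (i_lambda adj P).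
Proof.
move=> [T [e [c cE]]].
have cP t : exists g : {linear i_lambda adj P -> LAr^o},
    forall y, g y = Lmor (c t : {linear P -> regular R}) y.
  exact: extend_scalars_regular.
have [g gE] := choice cP.
exists T, (fun t => eta P (e t)), g => y.
have [f fE] : exists f : {linear L P -> L P},
    forall y, f y = \sum_t perp_act (Lmor (c t : {linear P -> regular R}) y) (eta P (e t)).
  apply: linear_exists => a x z; rewrite scaler_sumr -big_split.
  apply: eq_bigr => t _; rewrite linearP.
  exact: (linearP (@perp_act_on _ _ adj (L P) (eta P (e t)))).
transitivity (f y); last by rewrite fE; apply: eq_bigr => t _; rewrite gE.
symmetry; apply: (la_unique (g := f) (h := idfun)) => x.
rewrite fE /= {2}[x]cE linear_sum; apply: eq_bigr => t _.
by rewrite la_natural perp_act_eta linearZ.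
Qed.

Variables (I : lmodType R) (k : {linear I -> R^o}).
Variable theta : forall X, L X -> {linear I -> X}.
Hypotheses (I_dual : dual_basis I)
  (k_kills : forall a : R, kills a S <-> exists i, k i = a).
Hypotheses
  (* [theta] identifies [L X] with [Hom(I, X)], as in [left_adjoint_hom]. *)
  (theta_inj : forall (X : fgMod R) x y, theta (X := X) x =1 theta y -> x = y)
  (theta_surj : forall (X : fgMod R) (h : {linear I -> X}),
    exists y, theta (X := X) y =1 h)
  (theta_unit : forall (X : fgMod R) x i, theta (eta X x) i = (k i : R) *: x)
  (theta_scale : forall (X : fgMod R) y i, (k i : R) *: y = eta X (theta y i))
  (theta_natural : forall (X Y : fgMod R) (f : {linear X -> Y}) y i,
    theta (Lmor f y) i = f (theta y i)).

Lemma theta_zero (X : fgMod R) i : theta (0 : L X) i = 0.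
Proof. by rewrite -(linear0 (eta X)) theta_unit scaler0. Qed.

Lemma theta_eq0 (X : fgMod R) (y : L X) : (forall i, theta y i = 0) -> y = 0.
Proof. by move=> y0; apply: theta_inj => i; rewrite y0 theta_zero. Qed.

(** [Hom(I, _)] is exact because [I] is projective. *)
Lemma la_exact (X Y Z : fgMod R) (f : {linear X -> Y}) (g : {linear Y -> Z}) :
  exact_at f g -> exact_at (Lmor f) (Lmor g).
Proof.
move=> fg y; split=> [gy0|[x <-]]; last first.
  apply: theta_eq0 => i; rewrite !theta_natural; apply/fg.
  by exists (theta x i).
have [i|h hE] := dual_basis_lift (p := f) (f := theta y) I_dual.
  by apply/fg; rewrite -theta_natural gy0 theta_zero.
have [x xE] := theta_surj h; exists x.
by apply: theta_inj => i; rewrite theta_natural xE hE.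
Qed.

Lemma la_injective (X Y : fgMod R) (f : {linear X -> Y}) :
  injective f -> injective (Lmor f).
Proof.
move=> f_inj x y fxy; apply: theta_inj => i; apply: f_inj.
by rewrite -!theta_natural fxy.
Qed.

Lemma la_cpx_diffK (P : complex R) n x :
  Lmor (cpx_diff P (n + 1)) (Lmor (cpx_diff P n) x) = 0.
Proof.
apply: theta_eq0 => i; rewrite !theta_natural.
exact: cpx_diffK.
Qed.

Definition la_complex (P : complex R) : complex LAr :=
  @Complex LAr (fun n => i_lambda adj (P n))
    (fun n => extend_scalars (Lmor (cpx_diff P n)))
    (fun n x => la_cpx_diffK x).

Variables (s0 : S) (T : finType) (r e : T -> R).
Hypotheses (S_simple : simple_module S) (s0_neq0 : s0 <> 0)
  (units : matrix_units s0 r e).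

(** The kernel and the cokernel of the unit are killed by the annihilator of
    [S], so the four-term sequence applies. *)
Lemma hom_exact_unit (P : complex R) (X : fgMod R) :
  (forall n, dual_basis (P n)) -> hom_exact P S ->
  hom_exact P X <-> hom_exact P (L X).
Proof.
move=> P_dual exS.
have isoE := hom_exact_isotypic P_dual S_simple s0_neq0 units exS.
have [K [m [m_inj mE]]] := kernel_exists (eta X).
have [C [q [qE q_surj]]] := cokernel_exists (eta X).
apply: (hom_exact_four_terms P_dual m_inj mE qE q_surj); apply: isoE.
  move=> a /k_kills[i <-] x; apply: m_inj; rewrite linearZ linear0 /=.
  by rewrite -theta_unit (_ : eta X (m x) = 0) ?theta_zero //; apply/mE; exists x.
move=> a /k_kills[i <-] x; have [y <-] := q_surj x.
rewrite -linearZ theta_scale; apply/qE.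
by exists (theta y i).
Qed.

Section TotallyAcyclic.
Variable P : complex R.
Hypotheses (P_total : totally_acyclic P) (exS : hom_exact P S).

Let P_dual n : dual_basis (P n).
Proof. by have [projP _ _] := P_total; apply: projective_dual_basis. Qed.

Lemma hom_exact_la_regular : hom_exact P LA.
Proof.
apply: (iffLR (hom_exact_unit (regular R) P_dual exS)) => n f fd0.
by have [_ _ exR] := P_total; apply/exR.
Qed.

(** Maps over the localized ring from [L P] to the regular module are, by
    adjunction, the linear maps from [P] to [LA]. *)
Lemma la_totally_acyclic : totally_acyclic (la_complex P).
Proof.
have [_ acP _] := P_total.
split=> [n|n|n f]; first exact/dual_basis_projective/la_dual_basis.
  exact: la_exact (acP n).
split=> [fd0|[g gE] x]; last by rewrite -gE cpx_diffK linear0.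
have [f' f'E] := restrict_scalars_regular f.
have [x|g gE] := hom_exact_la_regular (f := f' \o eta (P (n + 1))).
  by rewrite /= -la_natural f'E -[RHS](fd0 (eta (P n) x)).
have [g' g'E] := la_universal adj g.
have [g'' g''E] := extend_scalars_regular g'.
exists g'' => x; rewrite g''E -f'E; move: x.
apply: (la_unique (g := g' \o Lmor (cpx_diff P (n + 1))) (h := f')) => x /=.
by rewrite la_natural g'E gE.
Qed.

End TotallyAcyclic.

Hypothesis S_exact : forall P : complex R, totally_acyclic P -> hom_exact P S.

Lemma i_lambda_gorenstein (X : fgMod R) :
  gorenstein_projective X -> gorenstein_projective (i_lambda adj X).
Proof.
move=> [P [j [totP j_inj jd]]].
exists (la_complex P), (extend_scalars (Lmor j)); split.
- exact/la_totally_acyclic/S_exact.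
- exact: la_injective.
exact: la_exact jd.
Qed.

(** [L X] is a summand of a power of [LA], so [Hom(P, _)] is exact at [L X],
    hence at [X]. Then the projection [q] of [P 0] onto [X], which kills
    boundaries, extends to a map on [P 1]; this is a retraction of the inclusion
    [j]. *)
Lemma projective_of_i_lambda (X : fgMod R) :
  gorenstein_projective X -> projective (i_lambda adj X) -> projective X.
Proof.
move=> [P [j [totP j_inj jd]]] /projective_dual_basis[J [e' [c cE]]].
have [projP acP _] := totP.
have P_dual n : dual_basis (P n) by exact: projective_dual_basis.
have exL : hom_exact P (L X).
  have [c' c'E] := choice (fun t => restrict_scalars_regular (c t)).
  apply: (hom_exact_summand (a := c') (b := fun t => @perp_act_on _ _ adj (L X) (e' t))).
    by move=> y; rewrite {1}[y]cE; apply: eq_bigr => t _; rewrite c'E.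
  exact: hom_exact_la_regular (S_exact totP).
have exX : hom_exact P X by apply/hom_exact_unit => //; exact: S_exact.
have [q qE] : exists q : {linear P 0 -> X}, forall x, j (q x) = cpx_diff P 0 x.
  apply: (linear_factor_inj (f := cpx_diff P 0)) => // x.
  by apply/jd; exact: (cpx_diffK (c := P) (n := 0)).
have [x|g gE] := exX (-1) q.
  by apply: j_inj; rewrite qE linear0; exact: (cpx_diffK (c := P) (n := -1)).
apply: (projective_retract (s := j) (r := g)) (projP 1) => x.
have [y yE] : exists y, cpx_diff P 0 y = j x by apply/(acP 0)/jd; exists x.
rewrite -yE [LHS](gE y); apply: j_inj.
by rewrite qE.
Qed.

End Localization.

(** * The theorem for artin algebras *)

Lemma artin_algebra_centrally_generated (k : comPzRingType) (A : algType k) :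
  artin_algebra A -> centrally_generated (A^o : lmodType A).
Proof.
move=> [_ [n [g gen]]]; exists 'I_n, g => x; have [c ->] := gen x.
exists (fun i => (c i)%:A) => [i b|].
  by rewrite -scalerAl -scalerAr mul1r mulr1.
by apply: eq_bigr => i _; rewrite -[RHS]/((c i)%:A * g i) mulr_algl.
Qed.

(** The map [rI] is right multiplication; it exists because the annihilator is
    two-sided, and it is the source of the left action on [Hom(I, X)]. *)
Lemma annihilator_exists (R : pzRingType) (S : lmodType R) :
  exists (I : lmodType R) (k : {linear I -> R^o}) (rI : I -> R -> I),
    [/\ injective k, forall a : R, kills a S <-> exists i, k i = a
      & forall i a, k (rI i a) = (k i : R) * a].
Proof.
have Ucl : submod_closed [pred a : R^o | `[< kills (a : R) S >]].
  split=> [|a x y]; first by apply/asboolP => s; rewrite scale0r.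
  move=> /asboolP kx /asboolP ky; apply/asboolP => s.
  by rewrite scalerDl -scalerA kx ky scaler0 addr0.
have [I [k [k_inj kE]]] := submodule_exists Ucl.
have kK (a : R) : kills a S <-> exists i, k i = a.
  by rewrite -kE inE; split=> /asboolP.
have rP (ia : I * R) : exists i', k i' = (k ia.1 : R) * ia.2.
  apply/kK => s; rewrite -scalerA.
  by have /kK -> : exists i, k i = k ia.1 by exists ia.1.
have [rI rIE] := choice rP.
by exists I, k, (fun i a => rI (i, a)); split=> // i a; rewrite rIE.
Qed.

Theorem proposition2p6 (k : comPzRingType) (A : algType k)
    (hA : artin_algebra A) (S : fgMod A) (S_simple : simple_module S)
    (S_loc : localizable S) (adj : left_adjoint S) :
  (forall X : fgMod A, gorenstein_projective X ->
     gorenstein_projective (i_lambda adj X)) /\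
  (cm_free (left_retraction_ring adj) -> cm_free A).
Proof.
have [[P1 [P0 [d [p [projP1 projP0 res]]]]] S_rigid] := S_loc.
have P1_dual := projective_dual_basis projP1.
have P0_dual := projective_dual_basis projP0.
have [[s0 s0_neq0] _] := S_simple.
have A_central := artin_algebra_centrally_generated hA.
have S_detected := centrally_generated_detected
  (centrally_generated_fin_gen A_central (fg_axiom S)).
have [T [r [e units]]] := matrix_units_exist S_simple s0_neq0 S_detected.
have [I [i [rI [i_inj i_kills rIE]]]] := annihilator_exists S.
have I_dual := annihilator_dual_basis S_simple s0_neq0 units P1_dual P0_dual
  res i_inj i_kills.
have [theta [theta_inj theta_surj theta_unit theta_scale theta_nat]] :=
  left_adjoint_hom S_simple s0_neq0 units P1_dual P0_dual res S_rigid i_inj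
    i_kills A_central rIE adj.
have S_exact P : totally_acyclic P -> hom_exact P S.
  move=> [projP _ exA].
  have P_dual n := projective_dual_basis (projP n).
  have exA' : hom_exact P (A^o : lmodType A) by move=> n f fd0; apply/exA.
  by apply: (hom_exact_quotient P_dual res); apply: hom_exact_dual_basis.
split=> [X|cmf X gX].
  exact: (i_lambda_gorenstein I_dual i_kills theta_inj theta_surj theta_unit
    theta_scale theta_nat S_simple s0_neq0 units S_exact).
have iX := i_lambda_gorenstein I_dual i_kills theta_inj theta_surj theta_unit
    theta_scale theta_nat S_simple s0_neq0 units S_exact gX.
exact: (projective_of_i_lambda i_kills theta_unit
    theta_scale S_simple s0_neq0 units S_exact gX (cmf _ iX)).
Qed.
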